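(* Let $\mathcal{I}=\left((\mathrm{E}_\alpha)_{\alpha\in I},(p_{\beta,\alpha})_{\beta\succcurlyeq\alpha}\right)$ be an inverse system in $\mathbf{NVL}$ and $\mathcal{S}=\left(\mathrm{E},(p_\alpha)_{\alpha\in I}\right)$ its inverse limit in $\mathbf{VL}$, with $\mathrm{E}$ realised as a sublattice of $\prod\mathrm{E}_\alpha$. The following statements are true. (i) Let $A\subseteq\mathrm{E}$ and assume that $\inf A=u$ or $\sup A=u$ in $\prod\mathrm{E}_\alpha$. Then $u\in\mathrm{E}$. (ii) If $\mathrm{E}_\alpha$ is Dedekind complete for every $\alpha\in I$, then $\mathcal{S}$ is the inverse limit of $\mathcal{I}$ in $\mathbf{NVL}$.
   Context: All vector lattices are real. $\mathbf{VL}$ and $\mathbf{NVL}$ are the categories of vector lattices with, respectively, (linear) lattice homomorphisms and normal lattice homomorphisms as morphisms; a lattice homomorphism is normal if it is order continuous, i.e. preserves arbitrary existing suprema and infima. $\prod\mathrm{E}_\alpha$ carries coordinatewise operations. An inverse system in a category $\mathbf{C}$ consists of a directed set $I$, vector lattices $\mathrm{E}_\alpha$ and $\mathbf{C}$-morphisms $p_{\beta,\alpha}:\mathrm{E}_\beta\to\mathrm{E}_\alpha$ ($\beta\succcurlyeq\alpha$) with $p_{\beta,\alpha}\circ p_{\gamma,\beta}=p_{\gamma,\alpha}$ for $\alpha\preccurlyeq\beta\preccurlyeq\gamma$. A compatible system in $\mathbf{C}$ is a vector lattice $\mathrm{E}$ with $\mathbf{C}$-morphisms $p_\alpha:\mathrm{E}\to\mathrm{E}_\alpha$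 satisfying $p_{\beta,\alpha}\circ p_\beta=p_\alpha$. The inverse limit in $\mathbf{C}$ is a compatible system $(\mathrm{E},(p_\alpha))$ such that for every compatible system $(\tilde{\mathrm{E}},(\tilde p_\alpha))$ in $\mathbf{C}$ there is a unique $\mathbf{C}$-morphism $s:\tilde{\mathrm{E}}\to\mathrm{E}$ with $p_\alpha\circ s=\tilde p_\alpha$ for all $\alpha$. The inverse limit in $\mathbf{VL}$ is realised as $\mathrm{E}=\{u=(u_\alpha)\in\prod\mathrm{E}_\alpha : u_\alpha=p_{\beta,\alpha}(u_\beta) \text{ for all } \alpha\preccurlyeq\beta\}$ with $p_\alpha$ the restriction to $\mathrm{E}$ of the coordinate projection. *)

(* Defs.v *)
From HB Require Import structures.
From mathcomp Require Import all_boot all_order all_algebra.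
From mathcomp Require Import all_classical all_reals.

Set Implicit Arguments.
Unset Strict Implicit.
Unset Printing Implicit Defensive.

Import Order.TTheory GRing.Theory Num.Theory.
Local Open Scope classical_set_scope.
Local Open Scope ring_scope.

(* The lattice operations are fields of the mixin rather than inherited from
   Order.Lattice, because Hierarchy Builder rejects a join of GRing.Lmodule and
   Order.Lattice declared on top of Num.RealDomain.  The canonical instance
   below turns every vector lattice into a latticeType ring_display. *)
HB.mixin Record POrderedLmodule_isVectorLattice (R : realType) V
    of GRing.Lmodule R V & Num.POrderedZmodule V := {
  vl_meet : V -> V -> V;
  vl_join : V -> V -> V;
  vl_meetP : forall x y z : V, (x <= vl_meet y z) = (x <= y) && (x <= z);
  vl_joinP : forall x y z : V, (vl_join x y <= z) = (x <= z) && (y <= z);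
  vl_lerD2l : forall z x y : V, x <= y -> z + x <= z + y;
  vl_scaler_ge0 : forall (a : R) (x : V), 0 <= a -> 0 <= x -> 0 <= a *: x
}.

#[short(type="vectorLatticeType")]
HB.structure Definition VectorLattice (R : realType) :=
  { V of POrderedLmodule_isVectorLattice R V & GRing.Lmodule R V
       & Num.POrderedZmodule V }.

HB.instance Definition _ (R : realType) (E : vectorLatticeType R) :=
  Order.POrder_MeetJoin_isLattice.Build ring_display (VectorLattice.sort E)
    vl_meetP vl_joinP.

Definition dedekind_complete (R : realType) (E : vectorLatticeType R) : Prop :=
  forall A : set E, A !=set0 -> ubound A !=set0 -> supremums A !=set0.

(* A category of vector lattices is given by the class of its morphisms. *)
Definition morphism_class (R : realType) : Type :=
  forall E F : vectorLatticeType R, (E -> F) -> Prop.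

Definition VL {R : realType} : morphism_class R := fun E F f =>
  [/\ linear f, Order.meet_morphism f & Order.join_morphism f].

(* Only suprema and infima of nonempty sets are required to be preserved: the
   empty set has a supremum in the zero space and in no other vector lattice,
   so the zero map from {0} is order continuous without preserving it. *)
Definition order_continuous (R : realType) (E F : vectorLatticeType R)
    (f : E -> F) : Prop :=
  forall A : set E, A !=set0 ->
    (forall u, supremums A u -> supremums (f @` A) (f u)) /\
    (forall u, infimums A u -> infimums (f @` A) (f u)).

Definition NVL {R : realType} : morphism_class R := fun E F f =>
  VL f /\ order_continuous f.

Record inverse_system (R : realType) (C : morphism_class R)
    (d : Order.disp_t) (I : preorderType d) : Type := InverseSystem {
  index_inhabited : inhabited I;
  index_directed : forall i j : I, exists k : I, (i <= k)%O && (j <= k)%O;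
  obj :> I -> vectorLatticeType R;
  trans : forall j i : I, (i <= j)%O -> obj j -> obj i;
  trans_mor : forall (j i : I) (ij : (i <= j)%O), C _ _ (trans ij);
  trans_comp : forall (i j k : I)
    (ij : (i <= j)%O) (jk : (j <= k)%O) (ik : (i <= k)%O),
    trans ij \o trans jk = trans ik
}.

Definition compatible_system (R : realType) (C : morphism_class R)
    (d : Order.disp_t) (I : preorderType d) (S : inverse_system C I)
    (E : vectorLatticeType R) (p : forall i, E -> S i) : Prop :=
  (forall i, C _ _ (p i)) /\
  (forall (j i : I) (ij : (i <= j)%O), trans ij \o p j = p i).

Arguments compatible_system {R} C {d I} S E p.

Definition is_inverse_limit (R : realType) (C : morphism_class R)
    (d : Order.disp_t) (I : preorderType d) (S : inverse_system C I)
    (E : vectorLatticeType R) (p : forall i, E -> S i) : Prop :=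
  compatible_system C S E p /\
  forall (E' : vectorLatticeType R) (p' : forall i, E' -> S i),
    compatible_system C S E' p' ->
    exists! s : E' -> E, C _ _ s /\ forall i, p i \o s = p' i.

Arguments is_inverse_limit {R} C {d I} S E p.

Definition forget_normal (R : realType) (d : Order.disp_t) (I : preorderType d)
    (S : inverse_system (@NVL R) I) : inverse_system (@VL R) I :=
  InverseSystem (index_inhabited S) (@index_directed _ _ _ _ S)
    (fun j i ij => (trans_mor S ij).1) (@trans_comp _ _ _ _ S).

Definition vlprod (R : realType) (I : Type) (E : I -> vectorLatticeType R)
  : Type := forall i, E i.

Section ProductVectorLattice.
Variables (R : realType) (I : Type) (E : I -> vectorLatticeType R).
Local Notation P := (vlprod E).
Implicit Types (u v w : P) (a b : R).

HB.instance Definition _ := Choice.copy P (forall i, E i).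

Definition vlprod_zero : P := fun=> 0.
Definition vlprod_opp u : P := fun i => - u i.
Definition vlprod_add u v : P := fun i => u i + v i.
Definition vlprod_scale a u : P := fun i => a *: u i.

Fact vlprod_addA : associative vlprod_add.
Proof. by move=> u v w; apply: functional_extensionality_dep => i; exact: addrA. Qed.
Fact vlprod_addC : commutative vlprod_add.
Proof. by move=> u v; apply: functional_extensionality_dep => i; exact: addrC. Qed.
Fact vlprod_add0 : left_id vlprod_zero vlprod_add.
Proof. by move=> u; apply: functional_extensionality_dep => i; exact: add0r. Qed.
Fact vlprod_addN : left_inverse vlprod_zero vlprod_opp vlprod_add.
Proof. by move=> u; apply: functional_extensionality_dep => i; exact: addNr. Qed.

HB.instance Definition _ :=
  GRing.isZmodule.Build P vlprod_addA vlprod_addC vlprod_add0 vlprod_addN.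

Fact vlprod_scaleA a b u :
  vlprod_scale a (vlprod_scale b u) = vlprod_scale (a * b) u.
Proof. by apply: functional_extensionality_dep => i; exact: scalerA. Qed.
Fact vlprod_scale1 : left_id 1 vlprod_scale.
Proof. by move=> u; apply: functional_extensionality_dep => i; exact: scale1r. Qed.
Fact vlprod_scaleDr : right_distributive vlprod_scale +%R.
Proof. by move=> a u v; apply: functional_extensionality_dep => i; exact: scalerDr. Qed.
Fact vlprod_scaleDl u : {morph vlprod_scale^~ u : a b / a + b}.
Proof. by move=> a b; apply: functional_extensionality_dep => i; exact: scalerDl. Qed.

HB.instance Definition _ := GRing.Zmodule_isLmodule.Build R P
  vlprod_scaleA vlprod_scale1 vlprod_scaleDr vlprod_scaleDl.

Definition vlprod_le u v : bool := `[< forall i, u i <= v i >].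
Definition vlprod_meet u v : P := fun i => Order.meet (u i) (v i).
Definition vlprod_join u v : P := fun i => Order.join (u i) (v i).

Fact vlprod_le_refl : reflexive vlprod_le.
Proof. by move=> u; apply/asboolP. Qed.
Fact vlprod_le_anti : antisymmetric vlprod_le.
Proof.
move=> u v /andP[/asboolP uv /asboolP vu].
by apply: functional_extensionality_dep => i; apply/le_anti; rewrite uv vu.
Qed.
Fact vlprod_le_trans : transitive vlprod_le.
Proof.
move=> v u w /asboolP uv /asboolP vw; apply/asboolP => i.
exact: le_trans (uv i) (vw i).
Qed.

HB.instance Definition _ := Order.Le_isPOrder.Build ring_display P
  vlprod_le_refl vlprod_le_anti vlprod_le_trans.

Fact vlprod_meetP u v w : (u <= vlprod_meet v w) = (u <= v) && (u <= w).
Proof.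
apply/asboolP/andP => [h|[/asboolP uv /asboolP uw] i].
  by split; apply/asboolP => i; move: (h i); rewrite lexI => /andP[].
by rewrite lexI uv uw.
Qed.
Fact vlprod_joinP u v w : (vlprod_join u v <= w) = (u <= w) && (v <= w).
Proof.
apply/asboolP/andP => [h|[/asboolP uw /asboolP vw] i].
  by split; apply/asboolP => i; move: (h i); rewrite leUx => /andP[].
by rewrite leUx uw vw.
Qed.

HB.instance Definition _ := Order.POrder_MeetJoin_isLattice.Build
  ring_display P vlprod_meetP vlprod_joinP.

Lemma vlprod_leP u v : reflect (forall i, u i <= v i) (u <= v).
Proof. exact: asboolP. Qed.

Fact vlprod_lerD2l w u v : u <= v -> w + u <= w + v.
Proof.
move=> /vlprod_leP uv; apply/vlprod_leP => i.
exact: (vl_lerD2l (w i) _ _ (uv i)).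
Qed.
Fact vlprod_scaler_ge0 a u : 0 <= a -> 0 <= u -> 0 <= a *: u.
Proof.
move=> a0 /vlprod_leP u0; apply/vlprod_leP => i.
exact: (vl_scaler_ge0 _ _ a0 (u0 i)).
Qed.

HB.instance Definition _ := POrderedLmodule_isVectorLattice.Build R P
  vlprod_meetP vlprod_joinP vlprod_lerD2l vlprod_scaler_ge0.

End ProductVectorLattice.

Section InverseLimit.
Variables (R : realType) (d : Order.disp_t) (I : preorderType d).
Variable S : inverse_system (@VL R) I.

Definition invlim_set : set (vlprod S) :=
  [set u | forall (i j : I) (ij : (i <= j)%O), u i = trans ij (u j)].

Definition invlim_pred : {pred vlprod S} := mem invlim_set.

Fact invlim_predP u : reflect (invlim_set u) (u \in invlim_pred).
Proof. by apply: (iffP idP) => h; [exact: set_mem h | exact: mem_set]. Qed.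

Record invlim : Type := Invlim {
  invlim_val : vlprod S;
  _ : invlim_val \in invlim_pred
}.

HB.instance Definition _ := [isSub for invlim_val].
HB.instance Definition _ := [Choice of invlim by <:].

Fact invlim_submod_closed : submod_closed invlim_pred.
Proof.
split=> [|a u v /invlim_predP hu /invlim_predP hv]; apply/invlim_predP => i j ij.
  have [lin _ _] := trans_mor S ij.
  by have := lin (-1) 0 0; rewrite scaleN1r addNr => ->; rewrite scaleN1r addNr.
have [lin _ _] := trans_mor S ij.
by rewrite [RHS]lin -hu -hv.
Qed.

HB.instance Definition _ := GRing.SubChoice_isSubLmodule.Build R (vlprod S)
  invlim_pred invlim invlim_submod_closed.

Fact invlim_meet_closed : Order.ClosedPredicates.meet_closed invlim_pred.
Proof.
move=> u v /invlim_predP hu /invlim_predP hv; apply/invlim_predP => i j ij.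
have [_ meet_ij _] := trans_mor S ij.
by rewrite [RHS]meet_ij -hu -hv.
Qed.
Fact invlim_join_closed : Order.ClosedPredicates.join_closed invlim_pred.
Proof.
move=> u v /invlim_predP hu /invlim_predP hv; apply/invlim_predP => i j ij.
have [_ _ join_ij] := trans_mor S ij.
by rewrite [RHS]join_ij -hu -hv.
Qed.

HB.instance Definition _ := Order.SubChoice_isSubLattice.Build ring_display
  (vlprod S) invlim_pred ring_display invlim
  invlim_meet_closed invlim_join_closed.

Fact invlim_lerD2l (w u v : invlim) : u <= v -> w + u <= w + v.
Proof. by rewrite -!Order.le_val !raddfD /=; apply: vl_lerD2l. Qed.
Fact invlim_scaler_ge0 (a : R) (u : invlim) : 0 <= a -> 0 <= u -> 0 <= a *: u.
Proof.
by rewrite -!Order.le_val linearZ raddf0 /=; apply: vl_scaler_ge0.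
Qed.

HB.instance Definition _ := POrderedLmodule_isVectorLattice.Build R invlim
  lexI leUx invlim_lerD2l invlim_scaler_ge0.

Definition invlim_proj (i : I) (u : invlim) : S i := invlim_val u i.

Lemma invlimP : is_inverse_limit VL S invlim invlim_proj.
Proof.
split.
  split=> [i|j i ij]; last first.
    apply: functional_extensionality_dep => u /=.
    case: u => u hu /=; move/invlim_predP: (hu) => hu'.
    by rewrite /invlim_proj /= [RHS](hu' i j ij).
  split.
  - move=> a u v.
    by rewrite /invlim_proj -[invlim_val _]/(val (a *: u + v)) linearP.
  - by [].
  - by [].
move=> E' p' [p'mor p'comp].
have p'lim x : (fun i => p' i x) \in invlim_pred.
  by apply/invlim_predP => i j ij; rewrite -(p'comp j i ij).
exists (fun x => Invlim (p'lim x)); split; last first.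
  move=> s [_ sp]; apply: functional_extensionality_dep => x; apply: val_inj.
  by apply: functional_extensionality_dep => i /=; rewrite -(sp i).
split=> [|i]; last exact: functional_extensionality_dep.
split.
- move=> a x y; apply: val_inj; rewrite linearP.
  by apply: functional_extensionality_dep => i /=; have [-> _ _] := p'mor i.
- move=> x y; apply: val_inj.
  by apply: functional_extensionality_dep => i /=; have [_ -> _] := p'mor i.
- move=> x y; apply: val_inj.
  by apply: functional_extensionality_dep => i /=; have [_ _ ->] := p'mor i.
Qed.

End InverseLimit.

Arguments invlim_set {R d I} S _.
Arguments invlim_proj {R d I} S i u.

(* Main.v *)
Require Import Defs.
From mathcomp Require Import all_boot all_order all_algebra.
From mathcomp Require Import all_classical all_reals.
Local Open Scope classical_set_scope.

(** Suprema in the product are computed coordinatewise, and each coordinate of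
    a supremum is carried to the next by the order continuous connecting maps,
    so the supremum of a set of threads is a thread.  If every factor is
    Dedekind complete, a set of threads bounded above by a thread has a
    supremum in the product; being a thread, it is also the supremum in the
    inverse limit, so the projections are order continuous.  Infima are reduced
    to suprema by the order reversing map [u |-> - u]. *)

Import Order.TTheory GRing.Theory Num.Theory.
Local Open Scope ring_scope.

Lemma supremums_unique {d} {T : porderType d} {A : set T} {u v : T} :
  supremums A u -> supremums A v -> u = v.
Proof. by move=> [Au uA] [Av vA]; apply/le_anti; rewrite uA // vA. Qed.

Section VectorLatticeSuprema.
Context {R : realType}.
Implicit Types E F : vectorLatticeType R.

Lemma vl_lerN2 {E} (x y : E) : (- x <= - y) = (y <= x).
Proof.
apply/idP/idP => h.
  by have := vl_lerD2l (x + y) _ _ h; rewrite addrK addrAC subrr add0r.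
by have := vl_lerD2l (- x - y) _ _ h; rewrite addrNK addrAC addNr add0r.
Qed.

Lemma infimums_oppP {E} (A : set E) (u : E) :
  infimums A u <-> supremums (-%R @` A) (- u).
Proof.
split=> [[Au uA]|[Au uA]]; split.
- by move=> _ [a Aa <-]; rewrite vl_lerN2; exact: Au.
- move=> w Aw; rewrite -[w]opprK vl_lerN2; apply: uA => a Aa.
  by rewrite -vl_lerN2 opprK; apply: Aw; exists a.
- by move=> a Aa; rewrite -vl_lerN2; apply: Au; exists a.
- move=> w Aw; rewrite -vl_lerN2; apply: uA => _ [a Aa <-].
  by rewrite vl_lerN2; exact: Aw.
Qed.

Lemma linear_oppr {E F} (f : E -> F) : linear f -> {morph f : x / - x}.
Proof.
move=> lin x.
have f0 : f 0 = 0.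
  by have := lin (-1) 0 0; rewrite scaleN1r addNr => ->; rewrite scaleN1r addNr.
by have := lin (-1) x 0; rewrite !scaleN1r !addr0 f0 addr0.
Qed.

(** A linear map commutes with negation, which exchanges suprema and infima, so only suprema have to
    be checked. *)
Lemma linear_order_continuous {E F} (f : E -> F) : linear f ->
  (forall A u, A !=set0 -> supremums A u -> supremums (f @` A) (f u)) ->
  order_continuous f.
Proof.
move=> lin fsup A A0; split=> u; first exact: fsup.
move=> /infimums_oppP Au; apply/infimums_oppP.
have {A0} NA0 : (-%R @` A) !=set0 by case: A0 => a Aa; exists (- a), a.
have := fsup _ _ NA0 Au; rewrite linear_oppr //.
have <- // : -%R @` (f @` A) = f @` (-%R @` A).
  by rewrite !image_comp; apply: eq_imagel => a _ /=; rewrite linear_oppr.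
Qed.

(** Such a [u] is a least element, so [u <= 0], while [u <= u + u] gives [0 <= u]. *)
Lemma supremums_set0_eq0 {E} (u : E) : supremums set0 u -> u = 0.
Proof.
move=> [_ u_min]; have ule v : u <= v by exact: u_min.
apply/le_anti/andP; split; first exact: ule.
by have := vl_lerD2l (- u) _ _ (ule (u + u)); rewrite addNr addKr.
Qed.

End VectorLatticeSuprema.

Section ProductSuprema.
Context {R : realType} {I : Type} {E : I -> vectorLatticeType R}.
Implicit Types (A : set (vlprod E)) (u : vlprod E).

Lemma vlprod_supremumsP A u :
  supremums A u <-> forall i, supremums ((fun v : vlprod E => v i) @` A) (u i).
Proof.
split=> [[Au uA] i|h]; split.
- by move=> _ [a Aa <-]; have /vlprod_leP := Au a Aa; apply.
- move=> w Aw.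
  (* [v] is [u] with its coordinate at [i] replaced by [w]. It still bounds [A], so [u <= v], and
     coordinate [i] reads [u i <= w]. The cast moves [w] from [E i] to [E j]. *)
  pose v : vlprod E := fun j => if pselect (i = j) is left ij
    then ecast j (E j) ij w else u j.
  have /uA /vlprod_leP/(_ i) : ubound A v.
    move=> a Aa; apply/vlprod_leP => j; rewrite /v.
    case: pselect => [ij|_]; last by have /vlprod_leP := Au a Aa; apply.
    by case: j / ij; apply: Aw; exists a.
  rewrite /v; case: pselect => [ii|/(_ erefl)//].
  (* Proof irrelevance turns the cast along [i = i] into the identity. *)
  by rewrite (Prop_irrelevance ii erefl).
- by move=> a Aa; apply/vlprod_leP => i; apply: (h i).1; exists a.
- move=> w Aw; apply/vlprod_leP => i; apply: (h i).2 => _ [a Aa <-].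
  by have /vlprod_leP := Aw a Aa; apply.
Qed.

End ProductSuprema.

Section NormalInverseLimit.
Context {R : realType} {d : Order.disp_t} {I : preorderType d}.
Variable S : inverse_system (@NVL R) I.
Let T := invlim_set (forget_normal S).

Lemma invlim_set_opp u : T u -> T (- u).
Proof.
move=> Tu i j ij; have [lin _ _] := (trans_mor S ij).1.
by rewrite [RHS](linear_oppr _ lin); congr (- _); exact: Tu.
Qed.

Lemma supremums_invlim_set (A : set (vlprod S)) u :
  A `<=` T -> supremums A u -> T u.
Proof.
(* Order continuity concerns nonempty sets only. A supremum of the empty set is 0, which is a
   thread. *)
move=> AT; have [->|A0] := eqVneq A set0.
  move=> /supremums_set0_eq0 ->.
  exact/invlim_predP/(invlim_submod_closed (forget_normal S)).1.
move=> /vlprod_supremumsP Au i j ij; have [_ oc] := trans_mor S ij.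
have Aj0 : ((fun v : vlprod S => v j) @` A) !=set0.
  by case/set0P: A0 => a Aa; exists (a j), a.
(* On threads, [trans ij] maps coordinate [j] to coordinate [i]. Hence [u i] and [trans ij (u j)]
   are suprema of the same set. *)
have := (oc _ Aj0).1 _ (Au j); rewrite image_comp => Aij.
apply: supremums_unique (Au i) _.
by rewrite (eq_imagel (f' := trans ij \o fun v => v j)) // => a /AT; apply.
Qed.

Lemma infimums_invlim_set (A : set (vlprod S)) u :
  A `<=` T -> infimums A u -> T u.
Proof.
move=> AT /infimums_oppP Au; rewrite -[u]opprK; apply: invlim_set_opp.
apply: supremums_invlim_set Au => _ [a /AT Ta <-]; exact: invlim_set_opp.
Qed.

Local Notation L := (invlim (forget_normal S)).
Local Notation proj := (invlim_proj (forget_normal S)).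

Lemma invlim_leP (u v : L) : reflect (forall i, proj i u <= proj i v) (u <= v).
Proof. by rewrite -Order.le_val; exact: vlprod_leP. Qed.

(** The order of the limit is coordinatewise. This serves both to recognise a coordinatewise
    supremum and to prove the mediating map normal. *)
Lemma invlim_supremums (A : set L) (u : L) :
  (forall i, supremums (proj i @` A) (proj i u)) -> supremums A u.
Proof.
move=> h; split=> [a Aa|w Aw]; apply/invlim_leP => i.
  by apply: (h i).1; exists a.
by apply: (h i).2 => _ [a Aa <-]; apply/invlim_leP: i; exact: Aw.
Qed.

Lemma invlim_proj_order_continuous :
  (forall i, dedekind_complete (S i)) -> forall i, order_continuous (proj i).
Proof.
move=> dc i; have [[+ _] _] := invlimP (forget_normal S).
move=> /(_ i)[lin _ _]; apply: linear_order_continuous => // A u A0 Au.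
have sup_proj j : exists x, supremums (proj j @` A) x.
  apply: dc; first by case: A0 => a Aa; exists (proj j a), a.
  by exists (proj j u) => _ [a Aa <-]; apply/invlim_leP: j; exact: Au.1.
(* The chosen coordinatewise suprema form a priori only a point of the product; [Tv] shows that it
   is a thread. *)
pose v : vlprod S := fun j => sval (cid (sup_proj j)).
have Av j : supremums (proj j @` A) (v j) by rewrite /v; case: cid.
have Tv : T v.
  apply: (@supremums_invlim_set (@invlim_val _ _ _ _ @` A)).
    by move=> _ [a _ <-]; apply/invlim_predP; exact: (valP a).
  by apply/vlprod_supremumsP => j; rewrite image_comp; exact: Av.
pose w : L := Invlim (introT (@invlim_predP _ _ _ (forget_normal S) v) Tv).
have -> : u = w by apply: supremums_unique Au _; exact: invlim_supremums.
exact: Av.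
Qed.

End NormalInverseLimit.

Theorem theorem4p5 (R : realType) (d : Order.disp_t) (I : preorderType d)
    (S : inverse_system (@NVL R) I) :
  (forall (A : set (vlprod S)) (u : vlprod S),
     A `<=` invlim_set (forget_normal S) ->
     infimums A u \/ supremums A u ->
     invlim_set (forget_normal S) u) /\
  ((forall i : I, dedekind_complete (S i)) ->
     is_inverse_limit NVL S (invlim (forget_normal S))
       (invlim_proj (forget_normal S))).
Proof.
split=> [A u AT [] Au|dc].
- exact: infimums_invlim_set Au.
- exact: supremums_invlim_set Au.
(* The universal property in [VL] supplies the mediating map and its uniqueness; what remains is the
   normality of the projections and of that map. *)
have [[pVL pcomp] univ] := invlimP (forget_normal S).
split; first by split=> // i; split=> //; exact: invlim_proj_order_continuous.
move=> E' p' [p'NVL p'comp].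
have [|s [[sVL ps] s_uniq]] := univ E' p'.
  by split=> // i; exact: (p'NVL i).1.
exists s; split=> [|s' [[s'VL _] ps']]; last exact: s_uniq.
split=> //; split=> //; have [lin _ _] := sVL.
(* Suprema are tested coordinatewise, where [s] becomes the order continuous map [p' i]. *)
apply: linear_order_continuous => // A u A0 Au; apply: invlim_supremums => i.
rewrite image_comp (ps i) -[invlim_proj _ i (s u)]/((_ \o s) u) (ps i).
by have [_ oc] := p'NVL i; exact: (oc A A0).1.
Qed.
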